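(* Let $t\ge1$ be an integer and let $\{\mathbf{x}_k\}_{k\ge0}\subset\mathrm{St}(d,r)^N$ be generated by the DRCS iteration $x_{i,k+1}=\mathrm{Retr}_{x_{i,k}}\big(-\alpha\,\mathrm{grad}\,\varphi^t_i(\mathbf{x}_k)\big)$, $i\in[N]$. Suppose that $\|\mathbf{x}_k-\bar{\mathbf{x}}_k\|_F\to0$ as $k\to\infty$ and $\mathbf{x}_k\ne\bar{\mathbf{x}}_k$ for all $k$. Then: (a) if $\alpha=\frac{2}{L_t+\mu_t}$, then $\displaystyle\limsup_{k\to\infty}\frac{\|\mathbf{x}_{k+1}-\bar{\mathbf{x}}_{k+1}\|_F}{\|\mathbf{x}_k-\bar{\mathbf{x}}_k\|_F}\le\frac{L_t-\mu_t}{L_t+\mu_t}$, and $\frac{L_t-\mu_t}{L_t+\mu_t}\le\sigma_2^t$; (b) if $\alpha=1$, then $\displaystyle\limsup_{k\to\infty}\frac{\|\mathbf{x}_{k+1}-\bar{\mathbf{x}}_{k+1}\|_F}{\|\mathbf{x}_k-\bar{\mathbf{x}}_k\|_F}\le\sigma_2^t$.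
   Context: Let $1\le r\le d$ and $N\ge2$ be integers, $[N]=\{1,\dots,N\}$, and $\mathrm{St}(d,r)=\{x\in\mathbb{R}^{d\times r}:x^\top x=I_r\}$. Inner products are $\langle x,y\rangle=\mathrm{Tr}(x^\top y)$ and $\|\cdot\|_F$ is the Frobenius norm, applied also to stacked tuples $\mathbf{x}=(x_1,\dots,x_N)$. $W\in\mathbb{R}^{N\times N}$ is the communication matrix of a connected undirected graph on $N$ nodes; it is symmetric and doubly stochastic, $W_{ij}\ge0$, $0<W_{ii}<1$, its eigenvalues lie in $(-1,1]$, and its second largest singular value $\sigma_2$ lies in $[0,1)$. $W^t_{ij}$ is the $(i,j)$ entry of the $t$-th power $W^t$. $\lambda_2(W^t)$ and $\lambda_N(W^t)$ are the second largest and the smallest eigenvalue of $W^t$; $\mu_t:=1-\lambda_2(W^t)$ and $L_t:=1-\lambda_N(W^t)$. $\varphi^t(\mathbf{x})=\frac14\sum_{i,j=1}^N W^t_{ij}\|x_i-x_j\|_F^2$. The Euclidean gradient has blocks $\nabla\varphi^t_i(\mathbf{x})=x_i-\sum_{j}W^t_{ij}x_j$, and the Riemannian gradient on $\mathrm{St}(d,r)^N$ has blocks $\mathrm{grad}\,\varphi^t_i(\mathbf{x})=\mathcal{P}_{T_{x_i}}(\nabla\varphi^t_i(\mathbf{x}))$ with $\mathcal{P}_{T_x}(y)=y-\frac12x(x^\top y+y^\top x)$. $\mathrm{Retr}_x(\xi)=(x+\xi)(I_r+\xi^\top\xi)^{-1/2}$ is the polar retraction. For $\mathbf{x}\in\mathrm{St}(d,r)^N$,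 the induced arithmetic mean (IAM) $\bar x$ is a minimizer of $\sum_i\|y-x_i\|_F^2$ over $y\in\mathrm{St}(d,r)$; $\bar{\mathbf{x}}=(\bar x,\dots,\bar x)$, and $\bar{\mathbf{x}}_k$ is the corresponding object for $\mathbf{x}_k$. *)

(* Defs.v *)
From HB Require Import structures.
From mathcomp Require Import all_boot all_order all_algebra.
From mathcomp Require Import all_classical all_reals all_analysis.

Set Implicit Arguments.
Unset Strict Implicit.
Unset Printing Implicit Defensive.

Import Order.TTheory GRing.Theory Num.Theory.
Import numFieldNormedType.Exports.

Local Open Scope classical_set_scope.
Local Open Scope ring_scope.

Definition finner (R : realType) (d r : nat) (x y : 'M[R]_(d, r)) : R :=
  \tr (x^T *m y).

Definition fnorm (R : realType) (d r : nat) (x : 'M[R]_(d, r)) : R :=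
  Num.sqrt (finner x x).

Definition stack_norm (R : realType) (d r N : nat)
    (x : 'I_N -> 'M[R]_(d, r)) : R :=
  Num.sqrt (\sum_(i < N) fnorm (x i) ^+ 2).

Definition Stiefel (R : realType) (d r : nat) : set 'M[R]_(d, r) :=
  [set x | x^T *m x = 1%:M].

(* The eigenvalues in nonincreasing order, repeated according to their        *)
(* algebraic multiplicity. This list is unique, and it exists whenever the    *)
(* characteristic polynomial splits over R, in particular for symmetric A;    *)
(* otherwise the value is the empty list.                                     *)
Definition spectrum (R : realType) (n : nat) (A : 'M[R]_n) : seq R :=
  xget [::] [set s : seq R |
    sorted (fun a b => b <= a) s /\ char_poly A = \prod_(a <- s) ('X - a%:P)].

(* k starts at 1: eigval A 1 is the largest eigenvalue, eigval A n the least. *)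
Definition eigval (R : realType) (n : nat) (A : 'M[R]_n) (k : nat) : R :=
  (spectrum A)`_k.-1.

Definition singval (R : realType) (n : nat) (A : 'M[R]_n) (k : nat) : R :=
  Num.sqrt (eigval (A^T *m A) k).

Definition posdefmx (R : realType) (n : nat) (A : 'M[R]_n) : Prop :=
  A^T = A /\ forall v : 'cV[R]_n, v != 0 -> 0 < (v^T *m A *m v) 0 0.

(* A^(-1/2): the unique positive definite square root of A^(-1), for A        *)
(* positive definite; 0 when there is no such root.                           *)
Definition invsqrtmx (R : realType) (n : nat) (A : 'M[R]_n) : 'M[R]_n :=
  xget 0 [set S | posdefmx S /\ S *m S = invmx A].

Definition polar_retr (R : realType) (d r : nat) (x xi : 'M[R]_(d, r)) :
    'M[R]_(d, r) :=
  (x + xi) *m invsqrtmx (1%:M + xi^T *m xi).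

Definition tangent_proj (R : realType) (d r : nat) (x y : 'M[R]_(d, r)) :
    'M[R]_(d, r) :=
  y - 2^-1 *: (x *m (x^T *m y + y^T *m x)).

(* W is a communication matrix of the connected simple graph on 'I_N with     *)
(* adjacency relation e.                                                      *)
Record communication_matrix (R : realType) (N : nat) (e : rel 'I_N)
    (W : 'M[R]_N) : Prop := CommunicationMatrix {
  comm_graph_sym : symmetric e;
  comm_graph_irr : irreflexive e;
  comm_graph_connected : forall i j, connect e i j;
  comm_edge : forall i j, i != j -> (0 < W i j) = e i j;
  comm_sym : W^T = W;
  comm_row_sum : forall i, \sum_(j < N) W i j = 1;
  comm_col_sum : forall j, \sum_(i < N) W i j = 1;
  comm_ge0 : forall i j, 0 <= W i j;
  comm_diag : forall i, 0 < W i i < 1;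
  comm_eigenvalue : forall a, eigenvalue W a -> -1 < a <= 1;
  comm_singval2 : 0 <= singval W 2 < 1
}.

Definition consensus_mu (R : realType) (N : nat) (W : 'M[R]_N) (t : nat) : R :=
  1 - eigval (W ^+ t) 2.

Definition consensus_L (R : realType) (N : nat) (W : 'M[R]_N) (t : nat) : R :=
  1 - eigval (W ^+ t) N.

Definition phi (R : realType) (d r N : nat) (W : 'M[R]_N) (t : nat)
    (x : 'I_N -> 'M[R]_(d, r)) : R :=
  4^-1 * \sum_(i < N) \sum_(j < N) (W ^+ t) i j * fnorm (x i - x j) ^+ 2.

(* The i-th block of the Euclidean gradient of phi; see phi_expansion.        *)
Definition egrad_phi (R : realType) (d r N : nat) (W : 'M[R]_N) (t : nat)
    (x : 'I_N -> 'M[R]_(d, r)) (i : 'I_N) : 'M[R]_(d, r) :=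
  x i - \sum_(j < N) (W ^+ t) i j *: x j.

Definition rgrad_phi (R : realType) (d r N : nat) (W : 'M[R]_N) (t : nat)
    (x : 'I_N -> 'M[R]_(d, r)) (i : 'I_N) : 'M[R]_(d, r) :=
  tangent_proj (x i) (egrad_phi W t x i).

Definition drcs_step (R : realType) (d r N : nat) (W : 'M[R]_N) (t : nat)
    (alpha : R) (x : 'I_N -> 'M[R]_(d, r)) (i : 'I_N) : 'M[R]_(d, r) :=
  polar_retr (x i) (- (alpha *: rgrad_phi W t x i)).

(* The minimizer need not be unique, hence a predicate.                       *)
Definition is_IAM (R : realType) (d r N : nat) (x : 'I_N -> 'M[R]_(d, r))
    (xbar : 'M[R]_(d, r)) : Prop :=
  Stiefel xbar /\ forall y, Stiefel y ->
    \sum_(i < N) fnorm (xbar - x i) ^+ 2 <= \sum_(i < N) fnorm (y - x i) ^+ 2.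

Definition consensus_err (R : realType) (d r N : nat)
    (x : 'I_N -> 'M[R]_(d, r)) (xbar : 'M[R]_(d, r)) : R :=
  stack_norm (fun i => x i - xbar).

Lemma finnerC (R : realType) (d r : nat) (x y : 'M[R]_(d, r)) :
  finner x y = finner y x.
Proof. by rewrite /finner -mxtrace_tr trmx_mul trmxK. Qed.

Lemma finnerDr (R : realType) (d r : nat) (x y z : 'M[R]_(d, r)) :
  finner x (y + z) = finner x y + finner x z.
Proof. by rewrite /finner mulmxDr mxtraceD. Qed.

Lemma finnerZr (R : realType) (d r : nat) a (x y : 'M[R]_(d, r)) :
  finner x (a *: y) = a * finner x y.
Proof. by rewrite /finner -scalemxAr mxtraceZ. Qed.

Lemma finnerNr (R : realType) (d r : nat) (x y : 'M[R]_(d, r)) :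
  finner x (- y) = - finner x y.
Proof. by rewrite -scaleN1r finnerZr mulN1r. Qed.

Lemma finnerBr (R : realType) (d r : nat) (x y z : 'M[R]_(d, r)) :
  finner x (y - z) = finner x y - finner x z.
Proof. by rewrite finnerDr finnerNr. Qed.

Lemma finner_sqrD (R : realType) (d r : nat) (x y : 'M[R]_(d, r)) :
  finner (x + y) (x + y) = finner x x + 2 * finner x y + finner y y.
Proof.
rewrite finnerDr ![finner (x + y) _]finnerC !finnerDr.
by rewrite [finner y x]finnerC mulr2n mulrDl mul1r !addrA.
Qed.

Lemma fnorm_sqr (R : realType) (d r : nat) (x : 'M[R]_(d, r)) :
  fnorm x ^+ 2 = finner x x.
Proof.
rewrite sqr_sqrtr // /finner /mxtrace sumr_ge0 // => i _.
by rewrite mxE sumr_ge0 // => j _; rewrite mxE -expr2 sqr_ge0.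
Qed.

(* The exact second-order expansion of the quadratic form phi, whose linear   *)
(* part identifies egrad_phi as its gradient.                                 *)
Lemma phi_expansion (R : realType) (d r N : nat) (W : 'M[R]_N) (t : nat)
    (x v : 'I_N -> 'M[R]_(d, r)) :
  W^T = W -> (forall i, \sum_(j < N) W i j = 1) ->
  phi W t (fun i => x i + v i) =
    phi W t x + \sum_(i < N) finner (egrad_phi W t x i) (v i) + phi W t v.
Proof.
move=> Wsym Wrow.
have Psym : (W ^+ t)^T = W ^+ t.
  elim: t => [|t IH]; first by rewrite expr0 trmx1.
  by rewrite [in LHS]exprS trmx_mul IH Wsym [in RHS]exprSr.
have Prow : forall i, \sum_(j < N) (W ^+ t) i j = 1.
  elim: {Psym} t => [|t IH] i.
    rewrite expr0 (bigD1 i) //= big1 ?addr0 ?mxE ?eqxx // => j ne.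
    by rewrite mxE eq_sym (negbTE ne).
  rewrite exprS; under eq_bigr do rewrite mxE.
  rewrite exchange_big /= -[RHS](Wrow i); apply: eq_bigr => j _.
  by rewrite -mulr_sumr IH mulr1.
set P := W ^+ t in Psym Prow *.
have PC i j : P i j = P j i by rewrite -[in LHS]Psym mxE.
have cross : \sum_i \sum_j P i j * finner (x i - x j) (v i - v j) =
    2 * \sum_i finner (egrad_phi W t x i) (v i).
  have half : \sum_i \sum_j P i j * finner (x i - x j) (v i) =
      \sum_i finner (egrad_phi W t x i) (v i).
    apply: eq_bigr => i _; rewrite /egrad_phi -/P.
    rewrite finnerC finnerBr -[X in X - _]mul1r -(Prow i) mulr_suml.
    rewrite (big_morph _ (finnerDr (v i)) (id1 := 0)); last first.
      by rewrite /finner mulmx0 mxtrace0.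
    rewrite -sumrB; apply: eq_bigr => j _.
    by rewrite finnerZr finnerC finnerBr mulrBr.
  rewrite mulr2n mulrDl mul1r -{1}half -half.
  rewrite [X in _ + X]exchange_big /= -big_split; apply: eq_bigr => i _.
  rewrite -big_split; apply: eq_bigr => j _ /=.
  rewrite finnerBr mulrBr; congr (_ + _).
  rewrite (PC j i) -mulrN; congr (_ * _).
  by rewrite -[x j - x i]opprB [RHS]finnerC finnerNr finnerC.
have -> : phi W t (fun i => x i + v i) = phi W t x +
    2^-1 * \sum_i \sum_j P i j * finner (x i - x j) (v i - v j) + phi W t v.
  have -> : 2^-1 = 4^-1 * 2 :> R.
    by rewrite -[4]/(2 * 2)%:R natrM invfM mulfVK // pnatr_eq0.
  rewrite /phi -/P -mulrA -!mulrDr; congr (_ * _).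
  rewrite mulr_sumr -!big_split /=.
  apply: eq_bigr => i _; rewrite mulr_sumr -!big_split.
  apply: eq_bigr => j _ /=.
  rewrite !fnorm_sqr opprD addrACA.
  by rewrite [in LHS]finner_sqrD !mulrDr (mulrCA (P i j)).
by rewrite cross mulrA mulVf ?pnatr_eq0 // mul1r.
Qed.

(* Main.v *)
Require Import Defs.
From HB Require Import structures.
From mathcomp Require Import all_boot all_order all_algebra.
From mathcomp Require Import all_classical all_reals all_analysis.
From mathcomp Require Import complex ring lra.

Set Implicit Arguments.
Unset Strict Implicit.
Unset Printing Implicit Defensive.

Import Order.TTheory GRing.Theory Num.Theory.
Import numFieldNormedType.Exports.

Local Open Scope classical_set_scope.
Local Open Scope ring_scope.

(* Write e = x_k - xbar_k.  The normal part of the Euclidean gradient and the   *)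
(* error of the polar retraction are both O(|e|^2), so one step sends e to     *)
(* ((1 - alpha) I + alpha W^t) e + O(|e|^2).  Optimality of the IAM makes the  *)
(* mean of e itself O(|e|^2), so only the spectrum of W^t on mean-zero vectors *)
(* matters, and replacing xbar_k by xbar_(k+1) only decreases the distance.    *)

(** The argument is a first-order perturbation near consensus. One step moves the stacked error by
    the linear map [mixing_mx], up to a remainder quadratic in the error, so the limsup of the
    ratios is bounded by any [rho] that bounds this map on stacks with zero sum.

    Three facts support this. On the Stiefel manifold the normal part of the gradient
    ([egrad_phi_normal]) and the retraction error ([polar_retr_approx]) are both quadratic;
    [drcs_step_linearization] combines them. Stationarity of the IAM ([maximizer_Stiefel_sym],
    [IAM_mean]) makes the sum of the errors quadratic, although the IAM is not the arithmetic mean.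
    Diagonalizing W ([consensus_rates]) reduces [rho] to a bound on |1 - alpha + alpha l| over the
    eigenvalues l of W^t other than the one carried by constants: these lie in [1 - L, 1 - mu] and
    have modulus at most sigma_2^t.

    [consensus_err_step] assembles E' <= rho E + c E^2; [drcs_limsup] divides by E and lets E tend
    to 0. *)

Lemma finner0r (R : realType) (d r : nat) (x : 'M[R]_(d, r)) : finner x 0 = 0.
Proof. by rewrite /finner mulmx0 mxtrace0. Qed.

Lemma finnerDl (R : realType) (d r : nat) (x y z : 'M[R]_(d, r)) :
  finner (x + y) z = finner x z + finner y z.
Proof. by rewrite finnerC finnerDr !(finnerC z). Qed.

Lemma finnerZl (R : realType) (d r : nat) a (x y : 'M[R]_(d, r)) :
  finner (a *: x) y = a * finner x y.
Proof. by rewrite finnerC finnerZr finnerC. Qed.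

Lemma finnerNl (R : realType) (d r : nat) (x y : 'M[R]_(d, r)) :
  finner (- x) y = - finner x y.
Proof. by rewrite finnerC finnerNr finnerC. Qed.

Lemma finner_sumr (R : realType) (d r N : nat) (x : 'M[R]_(d, r))
    (y : 'I_N -> 'M[R]_(d, r)) :
  finner x (\sum_i y i) = \sum_i finner x (y i).
Proof. by rewrite (big_morph _ (finnerDr x) (finner0r x)). Qed.

Lemma finnerE (R : realType) (d r : nat) (x y : 'M[R]_(d, r)) :
  finner x y = \sum_i \sum_j x i j * y i j.
Proof.
rewrite /finner /mxtrace exchange_big; apply: eq_bigr => j _.
by rewrite mxE; apply: eq_bigr => i _; rewrite mxE.
Qed.

Lemma fnorm_ge0 (R : realType) (d r : nat) (x : 'M[R]_(d, r)) : 0 <= fnorm x.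
Proof. exact: sqrtr_ge0. Qed.

Lemma fnorm0 (R : realType) (d r : nat) : fnorm (0 : 'M[R]_(d, r)) = 0.
Proof. by rewrite /fnorm finner0r sqrtr0. Qed.

Lemma fnormN (R : realType) (d r : nat) (x : 'M[R]_(d, r)) :
  fnorm (- x) = fnorm x.
Proof. by rewrite /fnorm finnerNr finnerC finnerNr opprK. Qed.

Lemma fnormZ (R : realType) (d r : nat) a (x : 'M[R]_(d, r)) :
  fnorm (a *: x) = `|a| * fnorm x.
Proof.
by rewrite /fnorm finnerZl finnerZr mulrA -expr2 sqrtrM ?sqr_ge0 // sqrtr_sqr.
Qed.

Lemma fnorm_eq0 (R : realType) (d r : nat) (x : 'M[R]_(d, r)) :
  fnorm x = 0 -> x = 0.
Proof.
move=> x0; have : fnorm x ^+ 2 = 0 by rewrite x0 expr0n.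
have sq_ge0 i j : 0 <= x i j * x i j by rewrite -expr2 sqr_ge0.
rewrite fnorm_sqr finnerE => /eqP.
rewrite psumr_eq0; last by move=> i _; rewrite sumr_ge0.
move=> /allP h; apply/matrixP => i j; rewrite mxE.
have := h i (mem_index_enum _); rewrite psumr_eq0 //.
by move=> /allP /(_ j (mem_index_enum _)); rewrite /= mulf_eq0 orbb => /eqP.
Qed.

Lemma finner_CauchySchwarz (R : realType) (d r : nat) (x y : 'M[R]_(d, r)) :
  finner x y <= fnorm x * fnorm y.
Proof.
have [/fnorm_eq0 ->|x0] := eqVneq (fnorm x) 0.
  by rewrite finnerC finner0r fnorm0 mul0r.
have [/fnorm_eq0 ->|y0] := eqVneq (fnorm y) 0.
  by rewrite finner0r fnorm0 mulr0.
have xy_gt0 : 0 < fnorm x * fnorm y.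
  by rewrite mulr_gt0 // lt_neqAle fnorm_ge0 eq_sym ?x0 ?y0.
have := sqr_ge0 (fnorm (fnorm y *: x - fnorm x *: y)).
rewrite fnorm_sqr finner_sqrD -scaleNr !finnerZl !finnerZr -!fnorm_sqr => h.
rewrite -(ler_pM2l xy_gt0); nra.
Qed.

Lemma fnormD (R : realType) (d r : nat) (x y : 'M[R]_(d, r)) :
  fnorm (x + y) <= fnorm x + fnorm y.
Proof.
rewrite -ler_sqr ?nnegrE ?addr_ge0 ?fnorm_ge0 // fnorm_sqr finner_sqrD.
rewrite -!fnorm_sqr; have := finner_CauchySchwarz x y; nra.
Qed.

Lemma fnormB (R : realType) (d r : nat) (x y : 'M[R]_(d, r)) :
  fnorm (x - y) <= fnorm x + fnorm y.
Proof. by rewrite (le_trans (fnormD _ _)) // fnormN. Qed.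

Lemma fnorm_sum (R : realType) (d r N : nat) (x : 'I_N -> 'M[R]_(d, r)) :
  fnorm (\sum_i x i) <= \sum_i fnorm (x i).
Proof.
elim/big_ind2: _ => [|u a v b ua vb|//]; first by rewrite fnorm0.
by rewrite (le_trans (fnormD _ _)) // lerD.
Qed.

Lemma fnorm_tr (R : realType) (d r : nat) (x : 'M[R]_(d, r)) :
  fnorm x^T = fnorm x.
Proof. by rewrite /fnorm /finner trmxK mxtrace_mulC. Qed.

Lemma fnorm_mul (R : realType) (m n p : nat) (x : 'M[R]_(m, n))
    (y : 'M[R]_(n, p)) : fnorm (x *m y) <= fnorm x * fnorm y.
Proof.
rewrite -ler_sqr ?nnegrE ?mulr_ge0 ?fnorm_ge0 // exprMn !fnorm_sqr.
rewrite (finnerE x) (finnerE (x *m y)) mulr_suml ler_sum // => i _.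
rewrite /finner /mxtrace mulr_sumr ler_sum // => j _.
have -> : (x *m y) i j = finner (row i x)^T (col j y).
  by rewrite finnerE mxE; apply: eq_bigr => k _; rewrite big_ord1 !mxE.
have -> : \sum_k x i k * x i k = fnorm (row i x)^T ^+ 2.
  by rewrite fnorm_sqr finnerE; apply: eq_bigr => k _; rewrite big_ord1 !mxE.
have -> : (y^T *m y) j j = fnorm (col j y) ^+ 2.
  by rewrite fnorm_sqr finnerE mxE; apply: eq_bigr => k _; rewrite big_ord1 !mxE.
have h := finner_CauchySchwarz (row i x)^T (col j y).
(* [finner_CauchySchwarz] is one-sided; negating the row gives the other half of the bound on the
   absolute value. *)
have := finner_CauchySchwarz (- (row i x)^T) (col j y).
rewrite fnormN finnerC finnerNr finnerC => h'.
rewrite -expr2 -exprMn -ler_sqrt ?sqr_ge0 // !sqrtr_sqr ler_norml.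
rewrite [`|_ * _|]ger0_norm ?mulr_ge0 ?fnorm_ge0 // h andbT; lra.
Qed.

Lemma fnorm_Stiefel_mul (R : realType) (d r n : nat) (x : 'M[R]_(d, r))
    (m : 'M[R]_(r, n)) : Stiefel x -> fnorm (x *m m) = fnorm m.
Proof.
by move=> hx; rewrite /fnorm /finner trmx_mul -mulmxA (mulmxA x^T) hx mul1mx.
Qed.

(** * Stacked tuples as matrices *)

(** With one flattened block per row, mixing the blocks by an N x N matrix becomes left
    multiplication and [stack_norm] becomes [fnorm]. *)
Definition stackmx (R : realType) (d r N : nat) (x : 'I_N -> 'M[R]_(d, r)) :
  'M[R]_(N, d * r) := \matrix_i mxvec (x i).

Lemma stack_normE (R : realType) (d r N : nat) (x : 'I_N -> 'M[R]_(d, r)) :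
  stack_norm x = fnorm (stackmx x).
Proof.
rewrite /stack_norm [RHS]/fnorm finnerE; congr Num.sqrt; apply: eq_bigr => i _.
rewrite fnorm_sqr finnerE pair_bigA (reindex _ (curry_mxvec_bij _ _)) /=.
by apply: eq_bigr => -[j k] _; rewrite /= !mxE !mxvecE.
Qed.

Lemma stackmxD (R : realType) (d r N : nat) (x y : 'I_N -> 'M[R]_(d, r)) :
  stackmx (fun i => x i + y i) = stackmx x + stackmx y.
Proof. by apply/row_matrixP => i; rewrite linearD /= !rowK linearD. Qed.

Lemma mulmx_stackmx (R : realType) (d r N : nat) (A : 'M[R]_N)
    (x : 'I_N -> 'M[R]_(d, r)) :
  A *m stackmx x = stackmx (fun i => \sum_j A i j *: x j).
Proof.
apply/row_matrixP => i; rewrite row_mul rowK mulmx_sum_row linear_sum.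
by apply: eq_bigr => j _; rewrite rowK mxE linearZ.
Qed.

Lemma fnorm_le_stack_norm (R : realType) (d r N : nat)
    (x : 'I_N -> 'M[R]_(d, r)) i : fnorm (x i) <= stack_norm x.
Proof.
rewrite -[leLHS]ger0_norm ?fnorm_ge0 // -sqrtr_sqr ler_sqrt; last first.
  by rewrite sumr_ge0 // => j _; rewrite sqr_ge0.
rewrite (bigD1 i) //= lerDl sumr_ge0 // => j _; exact: sqr_ge0.
Qed.

(** The crude factor [N%:R], in place of its square root, only affects constants in front of
    quadratic terms. *)
Lemma stack_norm_le (R : realType) (d r N : nat)
    (x : 'I_N -> 'M[R]_(d, r)) (c : R) :
  0 <= c -> (forall i, fnorm (x i) <= c) -> stack_norm x <= N%:R * c.
Proof.
move=> c0 hx.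
have Nc0 : 0 <= N%:R * c by rewrite mulr_ge0.
rewrite -[leRHS]ger0_norm // -sqrtr_sqr ler_sqrt ?sqr_ge0 //.
apply: (@le_trans _ _ (\sum_(i < N) c ^+ 2)).
  by apply: ler_sum => i _; rewrite ler_sqr ?nnegrE ?fnorm_ge0.
rewrite sumr_const card_ord -[leLHS]mulr_natl exprMn.
apply: ler_wpM2r; first exact: sqr_ge0.
by rewrite -natrX ler_nat; case: N {x hx Nc0} => // n; rewrite expnS leq_pmulr.
Qed.

(** * Spectral analysis of W and its powers *)

Local Notation toC A := (map_mx (real_complex _) A).

(** The rows of [U] are left eigenvectors. [U] is complex because the spectral theorem is applied
    over [R[i]], while the eigenvalues stay real; one [U] serves all polynomials in [A]. *)
Definition diagonalizes (R : realType) n (U : 'M[R[i]]_n) (A : 'M[R]_n)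
    (a : 'I_n -> R) : Prop :=
  U *m toC A = diag_mx (\row_i (a i)%:C%C) *m U.

Lemma diagonalizes_scalar (R : realType) n (U : 'M[R[i]]_n) (c : R) :
  diagonalizes U c%:M (fun=> c).
Proof.
rewrite /diagonalizes map_scalar_mx mul_mx_scalar; apply/matrixP => i j.
by rewrite mul_diag_mx !mxE.
Qed.

Lemma diagonalizesD (R : realType) n (U : 'M[R[i]]_n) (A B : 'M[R]_n) a b :
  diagonalizes U A a -> diagonalizes U B b ->
  diagonalizes U (A + B) (fun i => a i + b i).
Proof.
rewrite /diagonalizes map_mxD mulmxDr => -> ->; rewrite -mulmxDl; congr (_ *m _).
by apply/matrixP => i j; rewrite !mxE rmorphD mulrnDl.
Qed.

Lemma diagonalizesM (R : realType) n (U : 'M[R[i]]_n) (A B : 'M[R]_n) a b :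
  diagonalizes U A a -> diagonalizes U B b ->
  diagonalizes U (A *m B) (fun i => a i * b i).
Proof.
rewrite /diagonalizes map_mxM mulmxA => ->; rewrite -mulmxA => ->.
rewrite mulmxA mulmx_diag; congr (diag_mx _ *m _).
by apply/rowP => i; rewrite !mxE rmorphM.
Qed.

Lemma diagonalizesX (R : realType) n (U : 'M[R[i]]_n) (A : 'M[R]_n) a t :
  diagonalizes U A a -> diagonalizes U (A ^+ t) (fun i => a i ^+ t).
Proof.
move=> UA; elim: t => [|t IH]; first exact: diagonalizes_scalar.
rewrite exprS; have := diagonalizesM UA IH; rewrite /diagonalizes => ->.
by congr (diag_mx _ *m _); apply/rowP => i; rewrite !mxE exprS.
Qed.

Lemma symmetric_diagonalizes (R : realType) n (A : 'M[R]_n) : A^T = A ->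
  exists (U : 'M[R[i]]_n) (a : 'I_n -> R), U \is unitarymx /\ diagonalizes U A a.
Proof.
move=> As.
have Areal : toC A \is a mxOver Num.real.
  by apply/mxOverP => i j; rewrite mxE; apply/complex_realP; exists (A i j).
have Aherm : toC A \is hermsymmx.
  apply: realsym_hermsym Areal.
  by apply/is_hermitianmxP; rewrite expr0 scale1r map_trmx As map_mx_id.
have Anorm := hermitian_normalmx Aherm.
have /orthomx_spectralP Aeq := Anorm.
have dreal := hermitian_spectral_diag_real Aherm.
exists (spectralmx (toC A)), (fun i => complex.Re (spectral_diag (toC A) 0 i)).
split; first exact: spectral_unitarymx.
have Punit := spectral_unit (toC A).
move: (spectralmx (toC A)) (spectral_diag (toC A)) Punit Aeq dreal.
move=> P D Pu Aeq dreal.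
rewrite /diagonalizes Aeq !mulmxA mulmxV // mul1mx.
congr (diag_mx _ *m _); apply/rowP => i; rewrite !mxE; apply/esym/RRe_real.
by move/mxOverP: dreal.
Qed.

(** Similarity preserves the characteristic polynomial: over [R[i]] the nonzero factor det U is
    cancelled, and injectivity of the embedding brings the identity back to [R]. *)
Lemma char_poly_diagonalizes (R : realType) n (U : 'M[R[i]]_n) (A : 'M[R]_n) a :
  U \in unitmx -> diagonalizes U A a ->
  char_poly A = \prod_(x <- [seq a i | i <- enum 'I_n]) ('X - x%:P).
Proof.
move=> Uu UA; apply: (map_poly_inj (real_complex R)).
pose D := diag_mx (\row_i (a i)%:C%C).
have diagE : char_poly (toC A) = char_poly D.
  rewrite /char_poly /char_poly_mx.
  have uP : map_mx (@polyC _) U \in unitmx by rewrite map_unitmx.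
  have := congr1 (map_mx (@polyC R[i])) UA; rewrite !map_mxM /= => UAP.
  apply: (mulfI (x := \det (map_mx (@polyC _) U))).
    by move: uP; rewrite unitmxE; apply: contraL => /eqP ->; rewrite unitr0.
  rewrite -det_mulmx mulrC -det_mulmx; congr (\det _).
  by rewrite mulmxBr mulmxBl UAP mul_mx_scalar mul_scalar_mx.
rewrite map_char_poly diagE char_poly_trig ?diag_mx_is_trig //.
rewrite big_map big_enum rmorph_prod /=; apply: eq_bigr => i _.
by rewrite map_polyXsubC !mxE eqxx mulr1n.
Qed.

Lemma fnorm_unitary (R : realType) m n (U : 'M[R[i]]_m) (Y : 'M[R]_(m, n)) :
  U \is unitarymx ->
  ((fnorm Y ^+ 2)%:C)%C = \sum_i \sum_j `|(U *m toC Y) i j| ^+ 2.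
Proof.
move=> /unitarymxP /mulmx1C UU; rewrite fnorm_sqr /finner.
transitivity (\tr ((U *m toC Y)^t*%sesqui *m (U *m toC Y))).
  rewrite trmx_mul map_mxM mulmxA -(mulmxA _ _ U) UU mulmx1.
  rewrite -[LHS]trace_map_mx map_mxM; congr (\tr (_ *m _)).
  apply/matrixP => i j; rewrite !mxE. by rewrite [RHS]conjc_real.
rewrite /mxtrace exchange_big; apply: eq_bigr => j _.
rewrite mxE; apply: eq_bigr => i _.
by rewrite !mxE normCKC.
Qed.

(** In the eigenbasis [A] scales row i by [a i], and the only row whose factor is uncontrolled
    vanishes. *)
Lemma fnorm_mul_diagonalizes (R : realType) m n (U : 'M[R[i]]_m) (A : 'M[R]_m) a
    (Y : 'M[R]_(m, n)) (i0 : 'I_m) (rho : R) :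
  U \is unitarymx -> diagonalizes U A a -> 0 <= rho ->
  (forall i, i != i0 -> `|a i| <= rho) -> row i0 (U *m toC Y) = 0 ->
  fnorm (A *m Y) <= rho * fnorm Y.
Proof.
move=> Uu UA rho0 ha Y0.
rewrite -ler_sqr ?nnegrE ?mulr_ge0 ?fnorm_ge0 // exprMn -lecR.
have -> : ((rho ^+ 2 * fnorm Y ^+ 2)%:C = (rho ^+ 2)%:C * (fnorm Y ^+ 2)%:C)%C.
  exact: rmorphM.
rewrite !(fnorm_unitary _ Uu) mulr_sumr ler_sum // => i _.
rewrite mulr_sumr ler_sum // => j _.
have -> : (U *m toC (A *m Y)) i j = (a i)%:C%C * (U *m toC Y) i j.
  by rewrite map_mxM mulmxA UA -mulmxA mul_diag_mx !mxE.
have [->|ni] := eqVneq i i0.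
  have -> : (U *m toC Y) i0 j = 0.
    by have /rowP /(_ j) := Y0; rewrite !mxE.
  by rewrite mulr0 normr0 expr0n mulr0.
rewrite normrM exprMn ler_wpM2r ?exprn_ge0 //.
rewrite normc_def /= expr0n /= addr0 sqrtr_sqr -rmorphXn lecR.
by rewrite ler_sqr ?nnegrE ?ha.
Qed.

(** Linear factors determine the multiset of roots, and a sorted list is determined by its multiset,
    so the choice made by [spectrum] is forced. *)
Lemma spectrumE (R : realType) n (A : 'M[R]_n) (s : seq R) :
  char_poly A = \prod_(a <- s) ('X - a%:P) -> spectrum A = sort >=%R s.
Proof.
move=> hs; rewrite /spectrum; case: xgetP => [u _ [us hu]|].
  apply: (@sorted_eq _ >=%R) => //.
  - by move=> x y z /= h1 h2; apply: le_trans h2 h1.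
  - by move=> x y /andP [/= h1 h2]; apply/le_anti/andP.
  - by rewrite sort_sorted // => x y; rewrite /= le_total.
  - by rewrite perm_sym perm_sort; apply: prod_XsubC_eq; rewrite -hs.
move=> /(_ (sort >=%R s)) []; split.
  by rewrite sort_sorted // => x y; rewrite /= le_total.
by rewrite hs; apply: perm_big; rewrite perm_sym perm_sort.
Qed.

(* Only the position of the largest entry [f i0] is known, not where the      *)
(* other [f i] stand in the sorted list.                                      *)
Lemma sorted_second_last (R : realType) n (f : 'I_n -> R) (i0 : 'I_n)
    (s := sort >=%R [seq f i | i <- enum 'I_n]) :
  (forall i, f i <= f i0) ->
  (forall i, i != i0 -> s`_n.-1 <= f i <= s`_1) /\
  ((1 < n)%N -> exists i j, [/\ i != i0, j != i0, s`_1 = f i & s`_n.-1 = f j]).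
Proof.
move=> fmax.
pose q := [seq f i | i <- rem i0 (enum 'I_n)].
have tot : total (>=%R : rel R) by move=> x y; rewrite /= le_total.
have tr : transitive (>=%R : rel R) by move=> x y z /= h1 h2; apply: le_trans h2 h1.
have anti : antisymmetric (>=%R : rel R).
  by move=> x y /andP [/= h1 h2]; apply/le_anti/andP.
have sE : s = f i0 :: sort >=%R q.
  apply: (sorted_eq tr anti); first exact: sort_sorted.
    rewrite /= path_min_sorted ?sort_sorted //.
    by apply/allP => x; rewrite mem_sort => /mapP [i _ ->] /=.
  rewrite perm_sort perm_sym (perm_trans (_ : perm_eq _ (f i0 :: q))) //.
    by rewrite perm_cons perm_sort.
  by rewrite -map_cons perm_map // perm_sym perm_to_rem // mem_enum.
have memq i : i != i0 -> f i \in sort >=%R q.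
  move=> ni; rewrite mem_sort map_f // mem_rem_uniq ?enum_uniq //.
  by rewrite !inE ni mem_enum.
have sq : size (sort >=%R q) = n.-1.
  by rewrite size_sort size_map size_rem ?mem_enum // size_enum_ord.
have inq y : y \in q -> exists2 i, i != i0 & y = f i.
  move=> /mapP [i iq ->]; exists i => //; move: iq.
  by rewrite mem_rem_uniq ?enum_uniq // !inE => /andP [].
have nthq k : (k < n.-1)%N -> exists2 i, i != i0 & (sort >=%R q)`_k = f i.
  by move=> kn; apply: inq; rewrite -(mem_sort >=%R) mem_nth // sq.
(* Indices in the tail are one lower, so the last entry of [s] is entry [n.-2] of the sorted [q]. *)
have sn : (1 < n)%N -> s`_n.-1 = (sort >=%R q)`_n.-2.
  have pn m : (1 < m)%N -> m.-1 = m.-2.+1 by case: m => [|[|m]].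
  by move=> n1; rewrite sE pn.
split=> [i ni|n1].
  have /(nthP 0) [k kq <-] := memq i ni.
  rewrite sq in kq.
  have n1 : (1 < n)%N by rewrite -subn_gt0 subn1 (leq_ltn_trans _ kq).
  have n2 : (n.-2 < n.-1)%N by rewrite prednK // (leq_ltn_trans _ kq).
  have kn2 : (k <= n.-2)%N by rewrite -ltnS prednK // (leq_ltn_trans _ kq).
  have mono := sorted_leq_nth tr (fun x => lexx x) 0 (sort_sorted tot q).
  rewrite sn // sE /=; apply/andP; split; apply: mono; rewrite ?inE ?sq //.
  exact: leq_ltn_trans kq.
have n0 : (0 < n.-1)%N by rewrite -subn1 subn_gt0.
have [i ni iE] := nthq 0%N n0.
have [|j nj jE] := nthq n.-2; first by rewrite prednK.
by exists i, j; split=> //; rewrite ?sn // sE.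
Qed.

(** W fixes the constant vector, so every nonzero coordinate of U 1 belongs to eigenvalue 1. Since
    sigma_2 < 1, only one index [i0] qualifies; row [i0] of U is then constant and annihilates
    columns with zero sum. *)
Lemma comm_matrix_diagonalizes (R : realType) (N : nat) (e : rel 'I_N)
    (W : 'M[R]_N) : (1 < N)%N -> communication_matrix e W ->
  exists (U : 'M[R[i]]_N) (a : 'I_N -> R) (i0 : 'I_N),
    [/\ U \is unitarymx, diagonalizes U W a, a i0 = 1,
        forall i, i != i0 -> `|a i| <= singval W 2 &
        forall n (Y : 'M[R]_(N, n)), (forall j, \sum_k Y k j = 0) ->
          row i0 (U *m toC Y) = 0].
Proof.
move=> N1 hW.
have [U [a [Uu UW]]] := symmetric_diagonalizes (comm_sym hW).
have Uunit := unitarymx_unit Uu.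
pose one : 'cV[R[i]]_N := const_mx 1.
have W1 : toC W *m one = one.
  apply/colP => i; rewrite !mxE -[RHS](rmorph1 (real_complex R)).
  rewrite -(comm_row_sum hW i) rmorph_sum; apply: eq_bigr => j _.
  by rewrite !mxE mulr1.
have Uone i : (a i)%:C%C * (U *m one) i 0 = (U *m one) i 0.
  by rewrite -[in RHS]W1 mulmxA UW -mulmxA mul_diag_mx !mxE.
have [i0 c0] : exists i0, (U *m one) i0 0 != 0.
  apply: contrapT => /forallNP U0.
  have : one = 0.
    rewrite -(mulKmx Uunit one); have -> : U *m one = 0.
      by apply/colP => i; rewrite [RHS]mxE; apply/eqP/negPn/negP/U0.
    by rewrite mulmx0.
  move=> /colP /(_ (Ordinal N1)); rewrite !mxE => /eqP.
  by rewrite oner_eq0.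
have a1 i : (U *m one) i 0 != 0 -> a i = 1.
  move=> /mulIf Ui; have : (a i)%:C%C = 1 by apply: Ui; rewrite Uone mul1r.
  by case.
have ale1 i : `|a i| <= 1.
  have : eigenvalue W (a i).
    rewrite eigenvalue_root_char (char_poly_diagonalizes Uunit UW).
    by rewrite root_prod_XsubC map_f ?mem_enum.
  by move=> /(comm_eigenvalue hW) /andP [h1 h2]; rewrite ler_norml h2 ltW.
have asv i : i != i0 -> `|a i| <= singval W 2.
  move=> ni; rewrite /singval /eigval (comm_sym hW).
  have UWW := diagonalizesM UW UW.
  rewrite (spectrumE (char_poly_diagonalizes Uunit UWW)).
  (* The squares [a j * a j] are the eigenvalues of W^T W, with the largest at [i0]; any other is at
     most the second entry of the list, sigma_2^2. *)
  have fmax j : a j * a j <= a i0 * a i0.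
    rewrite (a1 i0 c0) mulr1 -expr2 -[leLHS]ger0_norm ?sqr_ge0 // normrX.
    by rewrite exprn_ile1.
  have [/(_ i ni) /andP [_ h] _] := sorted_second_last fmax.
  by rewrite -sqrtr_sqr ler_wsqrtr.
exists U, a, i0; split => //; first exact: a1.
move=> n Y Y0.
have U0 i : i != i0 -> (U *m one) i 0 = 0.
  move=> ni; apply/eqP/negPn/negP => /a1 ai.
  have := asv i ni; have /andP [_] := comm_singval2 hW.
  by rewrite ai normr1 => h1 h2; move: (lt_le_trans h1 h2); rewrite ltxx.
pose c := (U *m one) i0 0.
(* Expanding the constant vector in the rows of [U] leaves only the term of row [i0]. *)
have rowE k : U i0 k = (c^*%R)^-1.
  have /unitarymxP /mulmx1C UU := Uu.
  have : one k 0 = (U i0 k)^*%R * c.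
    rewrite -[in LHS](mul1mx one) -UU -mulmxA mxE (bigD1 i0) //= big1 ?addr0.
      by rewrite /c !mxE.
    by move=> i ni; rewrite U0 // mulr0.
  rewrite mxE => h; have cc0 : c^*%R != 0 by rewrite conjC_eq0.
  apply: (mulIf cc0); rewrite mulVf //; apply: (inv_inj (@conjCK R[i])).
  have -> : (U i0 k * c^*)^*%R = (U i0 k)^*%R * c^*^*%R by exact: rmorphM.
  by rewrite conjCK -h conjC1.
apply/rowP => j; rewrite !mxE.
under eq_bigr do rewrite rowE mxE.
by rewrite -mulr_sumr -rmorph_sum /= Y0 mulr0.
Qed.

(** The linearized step; scalars appear as scalar matrices so that [diagonalizesD] and
    [diagonalizesM] apply. *)
Definition mixing_mx (R : realType) (N : nat) (W : 'M[R]_N) (t : nat) (alpha : R) :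
  'M[R]_N := (1 - alpha)%:M + alpha%:M *m W ^+ t.

(** Keeping [alpha] and [rho] free reduces both step sizes to a scalar estimate. Positivity of [mu]
    and the rate bound hold because the second and last eigenvalues of W^t are attained at indices
    other than [i0]. *)
Lemma consensus_rates (R : realType) (N : nat) (e : rel 'I_N) (W : 'M[R]_N)
    (t : nat) (L := consensus_L W t) (mu := consensus_mu W t) :
  (1 < N)%N -> communication_matrix e W -> (0 < t)%N ->
  [/\ 0 < mu, mu <= L, (L - mu) / (L + mu) <= singval W 2 ^+ t &
    forall alpha rho : R, 0 <= rho ->
      (forall l, `|l| <= singval W 2 ^+ t -> 1 - L <= l <= 1 - mu ->
        `|1 - alpha + alpha * l| <= rho) ->
      forall n (Y : 'M[R]_(N, n)), (forall j, \sum_k Y k j = 0) ->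
        fnorm (mixing_mx W t alpha *m Y) <= rho * fnorm Y].
Proof.
move=> N1 hW t0.
have [U [a [i0 [Uu UW ai0 asv UY]]]] := comm_matrix_diagonalizes N1 hW.
have /andP [sv0 sv1] := comm_singval2 hW.
have Uunit := unitarymx_unit Uu.
have UWt := diagonalizesX t UW.
have apow i : i != i0 -> `|a i ^+ t| <= singval W 2 ^+ t.
  by move=> ni; rewrite normrX lerXn2r ?nnegrE ?asv.
have svt1 : singval W 2 ^+ t < 1 by rewrite exprn_ilt1 // -lt0n.
have fmax i : a i ^+ t <= a i0 ^+ t.
  have [-> //|ni] := eqVneq i i0.
  rewrite ai0 expr1n; apply: le_trans (ler_norm _) _.
  by rewrite (le_trans (apow i ni)) // ltW.
have [range [//|i [j [ni nj Ei Ej]]]] := sorted_second_last fmax.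
move: range Ei Ej; rewrite -(spectrumE (char_poly_diagonalizes Uunit UWt)).
rewrite -[_`_1]/(eigval (W ^+ t) 2) -[_`_N.-1]/(eigval (W ^+ t) N).
move=> range Ei Ej.
have EL : eigval (W ^+ t) N = 1 - L by rewrite /L /consensus_L; ring.
have Emu : eigval (W ^+ t) 2 = 1 - mu by rewrite /mu /consensus_mu; ring.
rewrite EL Emu in range Ei Ej.
have /ler_normlP [hi1 hi2] := apow i ni.
have /ler_normlP [hj1 hj2] := apow j nj.
have /andP [hij _] := range i ni.
have svt0 : 0 <= singval W 2 ^+ t by rewrite exprn_ge0.
rewrite -Ei -Ej in hi1 hi2 hj1 hj2 hij.
set sv := singval W 2 ^+ t in svt0 svt1 hi1 hi2 hj1 hj2 apow *.
have mu0 : 0 < mu by lra.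
have muL : mu <= L by lra.
split => //.
  (* With s = sigma_2^t, add (1 - mu) <= s times 1 + s and (L - 1) <= s times 1 - s. *)
  rewrite ler_pdivrMr; last by lra.
  by nra.
move=> alpha rho rho0 hrho n Y Y0.
apply: (fnorm_mul_diagonalizes (i0 := i0) Uu _ rho0 _ (UY n Y Y0)).
  apply: diagonalizesD; first exact: diagonalizes_scalar.
  by apply: diagonalizesM UWt; exact: diagonalizes_scalar.
by move=> k nk; apply: hrho; [apply: apow|apply: range].
Qed.

(** * Second-order accuracy of the polar retraction *)

Lemma trmxD (R : realType) (m n : nat) (A B : 'M[R]_(m, n)) :
  (A + B)^T = A^T + B^T.
Proof. exact: raddfD. Qed.

Lemma trmxB (R : realType) (m n : nat) (A B : 'M[R]_(m, n)) :
  (A - B)^T = A^T - B^T.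
Proof. exact: raddfB. Qed.

Lemma trmxZ (R : realType) (m n : nat) (c : R) (A : 'M[R]_(m, n)) :
  (c *: A)^T = c *: A^T.
Proof. exact: linearZ. Qed.

Lemma trmx_sum (R : realType) (m n N : nat) (A : 'I_N -> 'M[R]_(m, n)) :
  (\sum_i A i)^T = \sum_i (A i)^T.
Proof. exact: raddf_sum. Qed.

Lemma posdefmx_trace_ge0 (R : realType) (n p : nat) (S : 'M[R]_n)
    (Z : 'M[R]_(n, p)) : posdefmx S -> 0 <= \tr (Z^T *m S *m Z).
Proof.
move=> [_ Spos]; rewrite sumr_ge0 // => j _.
have -> : (Z^T *m S *m Z) j j = ((col j Z)^T *m S *m col j Z) 0 0.
  by rewrite tr_col -row_mul !mxE; apply: eq_bigr => k _; rewrite !mxE.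
have [->|nz] := eqVneq (col j Z) 0; last exact/ltW/Spos.
by rewrite mulmx0 mxE.
Qed.

(** Tangency gives (x + xi)^T (x + xi) = 1 + G with G = xi^T xi. If T is the square root of 1 + G
    and y the retracted point, the error is y (1 - T), of norm |1 - T| <= |1 - T^2| = |G|. *)
Lemma polar_retr_approx (R : realType) (d r : nat) (x xi : 'M[R]_(d, r)) :
  (0 < r)%N -> Stiefel x -> x^T *m xi + xi^T *m x = 0 ->
  Stiefel (polar_retr x xi) ->
  fnorm (polar_retr x xi - (x + xi)) <= fnorm xi ^+ 2.
Proof.
move=> r0 hx htan; rewrite /polar_retr /invsqrtmx.
(* In the default case [invsqrtmx] is 0, so the retracted point is 0, which is not in [Stiefel] as
   [0 < r]. *)
case: xgetP => [S _ [Spos _]|_]; last first.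
  rewrite mulmx0 /Stiefel /= mulmx0 => /matrixP /(_ (Ordinal r0) (Ordinal r0)).
  by rewrite !mxE eqxx => /eqP; rewrite eq_sym oner_eq0.
set G := xi^T *m xi; set y := (x + xi) *m S => hy.
have GE : (x + xi)^T *m (x + xi) = 1%:M + G.
  rewrite trmxD mulmxDl !mulmxDr hx -/G addrA -(addrA 1%:M) htan.
  by rewrite addr0.
have SGS : S *m ((1%:M + G) *m S) = 1%:M.
  by rewrite -GE -[RHS]hy /y trmx_mul (proj1 Spos) !mulmxA.
have Gs : (1%:M + G)^T = 1%:M + G by rewrite trmxD trmx1 /G trmx_mul trmxK.
have [T [ST Ts TT]] :
    exists T, [/\ S *m T = 1%:M, T^T = T & T *m T = 1%:M + G].
  exists ((1%:M + G) *m S); split=> //; last first.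
    by rewrite -mulmxA SGS mulmx1.
  rewrite trmx_mul Gs (proj1 Spos); set M := 1%:M + G in SGS *.
  transitivity (S *m M *m (S *m (M *m S))); first by rewrite SGS mulmx1.
  by rewrite mulmxA -(mulmxA S) SGS mul1mx.
have -> : y - (x + xi) = y *m (1%:M - T).
  by rewrite mulmxBr mulmx1 /y -[(x + xi) *m S *m T]mulmxA ST mulmx1.
rewrite fnorm_Stiefel_mul //; set X := 1%:M - T.
have XE : X + T *m X = - G.
  rewrite mulmxBr mulmx1 TT /X addrA subrK opprD addrA subrr.
  by rewrite add0r.
(* Since T = T S T, positivity of [S] suffices; the cross term in |X + T X|^2 is then nonnegative,
   whence |X| <= |G|. *)
have XT : 0 <= finner X (T *m X).
  rewrite /finner -{1}Ts -[T^T]mulmx1 -ST.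
  have -> : X^T *m (T^T *m (S *m T) *m X) = (T *m X)^T *m S *m (T *m X).
    by rewrite trmx_mul !mulmxA.
  exact: posdefmx_trace_ge0.
apply: (@le_trans _ _ (fnorm G)); last first.
  by rewrite (le_trans (fnorm_mul _ _)) // fnorm_tr.
rewrite -(fnormN G) -XE -ler_sqr ?nnegrE ?fnorm_ge0 //.
rewrite [leRHS]fnorm_sqr finner_sqrD -!fnorm_sqr.
have := sqr_ge0 (fnorm (T *m X)); lra.
Qed.

(** * First-order optimality of the induced arithmetic mean *)

(** [Q] is a plane rotation with cosine 1 + k and sine s: [P] projects on the plane, [O] is a
    quarter turn in it, and the scalar hypothesis says (1 + k)^2 + s^2 = 1. *)
Lemma skew_involution_rotation (R : realType) (d : nat) (P O : 'M[R]_d)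
    (k s : R) :
  P^T = P -> O^T = - O -> P *m P = P -> P *m O = O -> O *m P = O ->
  O *m O = - P -> k *+ 2 + k ^+ 2 + s ^+ 2 = 0 ->
  let Q := 1%:M + (k *: P + s *: O) in Q^T *m Q = 1%:M.
Proof.
move=> PT OT PP PO OP OO ks /=.
rewrite !trmxD !trmxZ PT OT trmx1 mulmxDl mul1mx mulmxDr mulmx1.
rewrite mulmxDl !mulmxDr -!scalemxAl -!scalemxAr mulNmx PP PO mulNmx OP OO.
rewrite opprK; apply/matrixP => i j; rewrite !mxE.
have := congr1 (fun z => z * P i j) ks; rewrite mul0r => /=.
lra.
Qed.

(** Rotating coordinates i and j of [x] stays in [Stiefel]. The first-order change of the inner
    product is proportional to M i j - M j i, which must vanish at a maximum. *)
Lemma maximizer_Stiefel_sym (R : realType) (d r : nat) (x h : 'M[R]_(d, r)) :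
  Stiefel x -> (forall y, Stiefel y -> finner y h <= finner x h) ->
  (h *m x^T)^T = h *m x^T.
Proof.
move=> hx hmax; set M := h *m x^T; apply/matrixP => i j; rewrite mxE.
have [-> //|nij] := eqVneq i j.
pose P : 'M[R]_d := delta_mx i i + delta_mx j j.
pose O : 'M[R]_d := delta_mx i j - delta_mx j i.
have nji : j != i by rewrite eq_sym.
have deltas := (mulmxDl, mulmxDr, mulNmx, mulmxN, mul_delta_mx_cond, eqxx,
  negbTE nij, negbTE nji, mulr0n, mulr1n, addr0, add0r, oppr0, @opprK 'M[R]_d).
have PT : P^T = P by rewrite trmxD !trmx_delta.
have OT : O^T = - O by rewrite trmxB !trmx_delta opprB.
have PP : P *m P = P by rewrite /P !deltas.
have PO : P *m O = O by rewrite /P /O !deltas.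
have OP : O *m P = O by rewrite /P /O !deltas // addrC.
have OO : O *m O = - P by rewrite /P /O !deltas opprD.
have rot_le k s : k *+ 2 + k ^+ 2 + s ^+ 2 = 0 ->
    k * (M i i + M j j) + s * (M i j - M j i) <= 0.
  move=> ks; have := skew_involution_rotation PT OT PP PO OP OO ks.
  set Q := 1%:M + _ => QQ.
  have /hmax : Stiefel (Q *m x).
    by rewrite /Stiefel /= trmx_mul mulmxA -(mulmxA _ Q^T) QQ mulmx1.
  have finM A : finner (A *m x) h = finner A M.
    by rewrite /finner trmx_mul -mulmxA mxtrace_mulC mulmxA.
  rewrite -[in finner x h](mul1mx x) !finM /Q finnerDl gerDl.
  rewrite finnerDl !finnerZl.
  have fdelta u v : finner (delta_mx u v) M = M u v.
    rewrite finnerE (bigD1 u) //= (bigD1 v) //= mxE !eqxx mul1r.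
    rewrite big1 => [|w /negbTE nw]; last by rewrite mxE nw andbF mul0r.
    rewrite addr0 big1 ?addr0 // => w /negbTE nw.
    by rewrite big1 // => z _; rewrite mxE nw mul0r.
  by rewrite !finnerDl finnerNl !fdelta.
set a := M i i + M j j in rot_le; set b := M i j - M j i in rot_le.
(* Half-angle parametrization of the circle, with [s] the tangent of half the angle. *)
have half s : s * b <= s ^+ 2 * a.
  have s1 : 0 < 1 + s ^+ 2 by rewrite ltr_pwDl ?sqr_ge0.
  have := rot_le (- (2 * s ^+ 2 / (1 + s ^+ 2))) (2 * s / (1 + s ^+ 2)).
  have s1n := lt0r_neq0 s1.
  have -> : - (2 * s ^+ 2 / (1 + s ^+ 2)) *+ 2 +
      (- (2 * s ^+ 2 / (1 + s ^+ 2))) ^+ 2 +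
      (2 * s / (1 + s ^+ 2)) ^+ 2 = 0 by field.
  move=> /(_ erefl).
  have -> : - (2 * s ^+ 2 / (1 + s ^+ 2)) * a + 2 * s / (1 + s ^+ 2) * b =
     2 * (s * b - s ^+ 2 * a) / (1 + s ^+ 2) by field.
  by rewrite pmulr_lle0 ?invr_gt0 // pmulr_rle0 // subr_le0.
have c0 : 0 < `|a| + 1 by rewrite ltr_wpDl.
set q := `|a| + 1 in c0; have qn := lt0r_neq0 c0.
(* This [s] has the sign of [b] and is small enough: since q - a >= 1, the inequality forces b^2 <=
   0. *)
have := half (b / q).
have -> : b / q * b = b ^+ 2 * q / q ^+ 2 by field.
have -> : (b / q) ^+ 2 * a = b ^+ 2 * a / q ^+ 2 by field.
rewrite ler_pM2r ?invr_gt0 ?exprn_gt0 // => hb.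
have b0 : b ^+ 2 <= 0.
  apply: le_trans (_ : b ^+ 2 * (q - a) <= 0).
    rewrite ler_peMr ?sqr_ge0 // /q; have := ler_norm a; lra.
  by rewrite mulrBr subr_le0.
have /eqP : b ^+ 2 = 0 by apply/le_anti; rewrite b0 sqr_ge0.
by rewrite sqrf_eq0 subr_eq0 => /eqP ->.
Qed.

(** All points of [Stiefel] have squared norm r, so minimizing the sum of squared distances amounts
    to maximizing a linear form. *)
Lemma IAM_optimal (R : realType) (d r N : nat) (x : 'I_N -> 'M[R]_(d, r)) xbar :
  is_IAM x xbar -> forall y, Stiefel y ->
  finner y (\sum_i x i) <= finner xbar (\sum_i x i).
Proof.
move=> [hx hmin] y hy; have := hmin y hy.
have E z : Stiefel z -> \sum_i fnorm (z - x i) ^+ 2 =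
    \sum_(i < N) (r%:R + fnorm (x i) ^+ 2) - 2 * finner z (\sum_i x i).
  move=> hz; rewrite finner_sumr mulr_sumr -sumrB; apply: eq_bigr => i _.
  rewrite fnorm_sqr finner_sqrD !finnerNr finnerNl opprK -[finner (x i) _]fnorm_sqr.
  by rewrite [finner z z]/finner hz mxtrace1; ring.
by rewrite !E //; lra.
Qed.

(* First-order optimality in St(d, r) puts the sum of the x_i in the normal    *)
(* space at xbar; the deviation from N xbar is therefore quadratic.           *)
Lemma IAM_mean (R : realType) (d r N : nat) (x : 'I_N -> 'M[R]_(d, r)) xbar :
  is_IAM x xbar -> (forall i, Stiefel (x i)) ->
  \sum_i (x i - xbar) =
    - (2^-1 *: (xbar *m \sum_i (x i - xbar)^T *m (x i - xbar))).
Proof.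
move=> hI hx; have hb : xbar^T *m xbar = 1%:M := proj1 hI.
set h := \sum_i x i.
have hs := maximizer_Stiefel_sym (proj1 hI) (IAM_optimal hI).
rewrite -/h trmx_mul trmxK in hs.
pose K := h^T *m xbar.
(* Symmetry of [h *m xbar^T], multiplied by [xbar] on the right. *)
have hK : h = xbar *m K.
  by rewrite /K mulmxA hs -mulmxA hb mulmx1.
have KE : xbar^T *m h = K by rewrite hK mulmxA hb mul1mx.
have eE i : (x i - xbar)^T *m (x i - xbar) =
    1%:M *+ 2 - (x i)^T *m xbar - xbar^T *m x i.
  rewrite trmxB mulmxBl !mulmxBr hx hb mulr2n; apply/matrixP => u v.
  by rewrite !mxE; ring.
under [in RHS]eq_bigr do rewrite eE.
rewrite !sumrB -mulmx_suml -mulmx_sumr -linear_sum /= -/h -/K KE.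
rewrite !sumr_const card_ord -mulrnA -(scaler_nat _ xbar)
  -(scaler_nat _ (1%:M : 'M[R]_r)) natrM !mulmxBr -scalemxAr.
rewrite mulmx1 -hK; apply/matrixP => u v; rewrite !mxE; lra.
Qed.

(** * Linearization of one step *)

Lemma comm_matrix_pow (R : realType) (N : nat) (e : rel 'I_N) (W : 'M[R]_N) t :
  communication_matrix e W ->
  (forall i j, 0 <= (W ^+ t) i j) /\ (forall i, \sum_j (W ^+ t) i j = 1).
Proof.
move=> hW; elim: t => [|t [IH0 IH1]].
  split=> [i j|i]; first by rewrite expr0 mxE.
  rewrite expr0 (bigD1 i) //= big1 ?addr0 ?mxE ?eqxx // => j ne.
  by rewrite mxE eq_sym (negbTE ne).
split=> [i j|i]; rewrite exprS.
  by rewrite mxE sumr_ge0 // => k _; rewrite mulr_ge0 ?(comm_ge0 hW).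
under eq_bigr do rewrite mxE.
rewrite exchange_big /= -[RHS](comm_row_sum hW i); apply: eq_bigr => j _.
by rewrite -mulr_sumr IH1 mulr1.
Qed.

Lemma fnorm_convex_sum (R : realType) (d r N : nat) (p : 'I_N -> R)
    (y : 'I_N -> 'M[R]_(d, r)) (c : R) :
  (forall j, 0 <= p j) -> \sum_j p j = 1 -> (forall j, fnorm (y j) <= c) ->
  fnorm (\sum_j p j *: y j) <= c.
Proof.
move=> p0 p1 yc; apply: le_trans (fnorm_sum _) _.
rewrite -[leRHS]mul1r -p1 mulr_suml ler_sum // => j _.
by rewrite fnormZ ger0_norm // ler_wpM2l.
Qed.

Lemma tangent_proj_tangent (R : realType) (d r : nat) (x y : 'M[R]_(d, r)) :
  Stiefel x ->
  x^T *m tangent_proj x y + (tangent_proj x y)^T *m x = 0.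
Proof.
move=> hx; rewrite /tangent_proj trmxB trmxZ trmx_mul trmxD !trmx_mul !trmxK.
rewrite mulmxBr mulmxBl -scalemxAr -scalemxAl mulmxA hx mul1mx -mulmxA hx mulmx1.
by apply/matrixP => i j; rewrite !mxE; lra.
Qed.

Lemma egrad_phiE (R : realType) (d r N : nat) (W : 'M[R]_N) t
    (x : 'I_N -> 'M[R]_(d, r)) i : \sum_j (W ^+ t) i j = 1 ->
  egrad_phi W t x i = \sum_j (W ^+ t) i j *: (x i - x j).
Proof.
move=> P1; under eq_bigr do rewrite scalerBr.
by rewrite sumrB -scaler_suml P1 scale1r.
Qed.

(* The normal component of the Euclidean gradient at x_i is quadratic in the   *)
(* disagreements, so tangent projection is invisible at first order.          *)
Lemma egrad_phi_normal (R : realType) (d r N : nat) (W : 'M[R]_N) t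
    (x : 'I_N -> 'M[R]_(d, r)) i : \sum_j (W ^+ t) i j = 1 ->
  (forall j, Stiefel (x j)) ->
  (x i)^T *m egrad_phi W t x i + (egrad_phi W t x i)^T *m x i =
    \sum_j (W ^+ t) i j *: ((x i - x j)^T *m (x i - x j)).
Proof.
move=> P1 hx; rewrite egrad_phiE // trmx_sum mulmx_sumr mulmx_suml.
rewrite -big_split; apply: eq_bigr => j _ /=.
rewrite trmxZ -scalemxAr -scalemxAl -scalerDr trmxB; congr (_ *: _).
rewrite !mulmxBl !mulmxBr !hx.
by apply/matrixP => u v; rewrite !mxE; ring.
Qed.

(** Disagreements are at most 2E, so the Euclidean gradient is at most 2E and its normal part at
    most 2E^2. As E <= 1, the Riemannian gradient is at most 4E, and the retraction costs at most (4
    |alpha| E)^2. *)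
Lemma drcs_step_linearization (R : realType) (d r N : nat) (e : rel 'I_N)
    (W : 'M[R]_N) t (alpha : R) (x : 'I_N -> 'M[R]_(d, r)) xbar
    (E := consensus_err x xbar) :
  (0 < r)%N -> communication_matrix e W -> (forall i, Stiefel (x i)) ->
  (forall i, Stiefel (drcs_step W t alpha x i)) -> E <= 1 ->
  forall i, fnorm (drcs_step W t alpha x i -
      (x i - alpha *: egrad_phi W t x i)) <=
    (2 * `|alpha| + 16 * alpha ^+ 2) * E ^+ 2.
Proof.
move=> r0 hW hx hstep E1 i.
have [P0 P1] := comm_matrix_pow t hW.
have E0 : 0 <= E by rewrite sqrtr_ge0.
have hd j : fnorm (x i - x j) <= 2 * E.
  have -> : x i - x j = (x i - xbar) - (x j - xbar).
    by rewrite opprB addrA subrK.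
  rewrite (le_trans (fnormB _ _)) // mulr2n mulrDl mul1r lerD //.
    exact: (fnorm_le_stack_norm (fun i => x i - xbar)).
  exact: (fnorm_le_stack_norm (fun i => x i - xbar)).
have heg : fnorm (egrad_phi W t x i) <= 2 * E.
  by rewrite egrad_phiE // fnorm_convex_sum.
have hG : fnorm (rgrad_phi W t x i - egrad_phi W t x i) <= 2 * E ^+ 2.
  rewrite /rgrad_phi /tangent_proj egrad_phi_normal // addrAC subrr sub0r.
  rewrite fnormN fnormZ fnorm_Stiefel_mul // ger0_norm ?invr_ge0 //.
  have : fnorm (\sum_j (W ^+ t) i j *: ((x i - x j)^T *m (x i - x j)))
      <= (2 * E) ^+ 2.
    apply: fnorm_convex_sum => // j.
    rewrite (le_trans (fnorm_mul _ _)) // fnorm_tr -expr2.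
    by rewrite ler_sqr ?nnegrE ?fnorm_ge0 ?mulr_ge0.
  lra.
have hg : fnorm (rgrad_phi W t x i) <= 4 * E.
  rewrite -[rgrad_phi _ _ _ _](subrK (egrad_phi W t x i)).
  rewrite (le_trans (fnormD _ _)) //; nra.
set xi := - (alpha *: rgrad_phi W t x i).
have hxi : fnorm xi <= `|alpha| * (4 * E).
  by rewrite fnormN fnormZ ler_wpM2l.
have htan : (x i)^T *m xi + xi^T *m x i = 0.
  rewrite /xi -scaleNr trmxZ -scalemxAr -scalemxAl -scalerDr.
  by rewrite tangent_proj_tangent // scaler0.
have hretr := polar_retr_approx r0 (hx i) htan (hstep i).
have -> : drcs_step W t alpha x i - (x i - alpha *: egrad_phi W t x i) =
    (polar_retr (x i) xi - (x i + xi)) -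
      alpha *: (rgrad_phi W t x i - egrad_phi W t x i).
  rewrite /drcs_step -/xi scalerBr /xi.
  by apply/matrixP => u v; rewrite !mxE; ring.
rewrite (le_trans (fnormB _ _)) // fnormZ mulrDl addrC lerD //.
  by rewrite (mulrC 2) -mulrA ler_wpM2l.
rewrite (le_trans hretr) //; have -> : 16 * alpha ^+ 2 * E ^+ 2 =
    (`|alpha| * (4 * E)) ^+ 2 by rewrite !exprMn real_normK ?num_real //; ring.
by rewrite ler_sqr ?nnegrE ?fnorm_ge0 ?mulr_ge0.
Qed.

(** The error splits into a zero-sum part [Y], contracted by [rho], and its mean [C], of norm at
    most E^2 / 2 by [IAM_mean]. The reference point is still the old [xbar]. *)
Lemma consensus_err_step (R : realType) (d r N : nat) (e : rel 'I_N)
    (W : 'M[R]_N) t (alpha rho : R) (x : 'I_N -> 'M[R]_(d, r)) xbar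
    (E := consensus_err x xbar) :
  (0 < r)%N -> (0 < N)%N -> communication_matrix e W ->
  (forall i, Stiefel (x i)) -> is_IAM x xbar ->
  (forall i, Stiefel (drcs_step W t alpha x i)) -> E <= 1 -> 0 <= rho ->
  (forall n (Y : 'M[R]_(N, n)), (forall j, \sum_k Y k j = 0) ->
     fnorm (mixing_mx W t alpha *m Y) <= rho * fnorm Y) ->
  consensus_err (drcs_step W t alpha x) xbar <=
    rho * E + ((rho + 1) / 2 +
      N%:R * (2 * `|alpha| + 16 * alpha ^+ 2)) * E ^+ 2.
Proof.
move=> r0 N0 hW hx hI hstep E1 rho0 hmix.
have [P0 P1] := comm_matrix_pow t hW.
have E0 : 0 <= E by rewrite sqrtr_ge0.
have Nn0 : N%:R != 0 :> R by rewrite pnatr_eq0 -lt0n.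
pose err i := x i - xbar.
pose c := N%:R^-1 *: \sum_i err i.
pose rem i := drcs_step W t alpha x i - (x i - alpha *: egrad_phi W t x i).
pose Y := stackmx (fun i => err i - c); pose C := stackmx (fun _ : 'I_N => c).
pose A := mixing_mx W t alpha.
have AE i j : A i j = (1 - alpha) *+ (i == j) + alpha * (W ^+ t) i j.
  by rewrite /A /mixing_mx mul_scalar_mx !mxE.
have A1 i : \sum_j A i j = 1.
  under eq_bigr do rewrite AE.
  rewrite big_split -mulr_sumr P1 mulr1 (bigD1 i) //= eqxx big1 ?addr0 ?subrK //.
  by move=> j; rewrite eq_sym => /negbTE ->.
have -> : consensus_err (drcs_step W t alpha x) xbar =
    fnorm (A *m Y + C + stackmx rem).
  rewrite /consensus_err stack_normE; congr fnorm.
  (* Rows of [A] sum to 1, so constant stacks are fixed. *)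
  have -> : C = A *m C.
    rewrite mulmx_stackmx; congr stackmx; apply/funext => i.
    by rewrite -scaler_suml A1 scale1r.
  rewrite -mulmxDr -stackmxD mulmx_stackmx -stackmxD; congr stackmx.
  apply/funext => i; rewrite /rem.
  under eq_bigr do rewrite subrK AE scalerDl -scalerA.
  rewrite big_split /= -scaler_sumr (bigD1 i) //= eqxx big1 ?addr0; last first.
    by move=> j; rewrite eq_sym => /negbTE ->; rewrite scale0r.
  have -> : \sum_j (W ^+ t) i j *: err j = err i - egrad_phi W t x i.
    rewrite /err /egrad_phi; under eq_bigr do rewrite scalerBr.
    rewrite sumrB -scaler_suml P1 scale1r.
    by apply/matrixP => u v; rewrite !mxE; ring.
  rewrite /err mulr1n.
  move: (drcs_step _ _ _ _ _) (egrad_phi _ _ _ _) => y g.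
  by apply/matrixP => u v; rewrite !mxE; ring.
have sumE : fnorm (\sum_i err i) <= E ^+ 2 / 2.
  rewrite (IAM_mean hI hx) fnormN fnormZ fnorm_Stiefel_mul; last exact: (proj1 hI).
  rewrite ger0_norm ?invr_ge0 // mulrC ler_wpM2r ?invr_ge0 //.
  rewrite (le_trans (fnorm_sum _)) // /E /consensus_err /stack_norm sqr_sqrtr.
    apply: ler_sum => i _; rewrite (le_trans (fnorm_mul _ _)) //.
    by rewrite fnorm_tr expr2.
  by rewrite sumr_ge0 // => i _; rewrite sqr_ge0.
have hC : fnorm C <= E ^+ 2 / 2.
  rewrite -stack_normE; apply: le_trans (stack_norm_le (fnorm_ge0 c) _) _ => //.
  by rewrite fnormZ ger0_norm ?invr_ge0 // mulrA divff // mul1r.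
have hY : fnorm Y <= E + E ^+ 2 / 2.
  have errE : stackmx err = Y + C.
    by rewrite -stackmxD; congr stackmx; apply/funext => i; rewrite subrK.
  have -> : Y = stackmx err - C by rewrite errE addrK.
  by rewrite (le_trans (fnormB _ _)) // lerD // -stack_normE.
have Y0 j : \sum_k Y k j = 0.
  have -> : \sum_k Y k j = mxvec (\sum_k (err k - c)) 0 j.
    by rewrite linear_sum summxE; apply: eq_bigr => k _; rewrite mxE.
  rewrite sumrB sumr_const card_ord -scaler_nat /c scalerA divff // scale1r.
  by rewrite subrr linear0 mxE.
have hrem : fnorm (stackmx rem) <=
    N%:R * ((2 * `|alpha| + 16 * alpha ^+ 2) * E ^+ 2).
  rewrite -stack_normE; apply: stack_norm_le.
    by rewrite mulr_ge0 ?sqr_ge0 // addr_ge0 // mulr_ge0 ?sqr_ge0.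
  exact: drcs_step_linearization hW hx hstep E1.
apply: le_trans (fnormD _ _) _.
apply: le_trans (lerD (fnormD _ _) (lexx _)) _.
apply: le_trans (lerD (lerD (hmix _ _ Y0) hC) hrem) _.
have := ler_wpM2l rho0 hY; rewrite -/A; lra.
Qed.

(** * Passage to the limsup *)

Lemma limn_esup_le_linear (R : realType) (u E : nat -> R) (l c : R) :
  0 <= c -> E @ \oo --> 0 ->
  (\forall k \near \oo, u k <= l + c * E k) ->
  (limn_esup (fun k => (u k)%:E) <= l%:E)%E.
Proof.
move=> c0 E0 hu; apply/lee_addgt0Pr => eps eps0.
have cE : (fun k => c * E k) @ \oo --> 0.
  by rewrite -[0](mulr0 c); apply: cvgM E0; exact: cvg_cst.
have near_le : \forall k \near \oo, u k <= l + eps.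
  have /cvgrPdist_le /(_ _ eps0) := cE; apply: filterS2 hu => k h.
  rewrite sub0r normrN => /(le_trans (ler_norm _)) h'.
  by rewrite (le_trans h) // lerD2l.
rewrite /limn_esup /limf_esup.
apply: (@le_trans _ _ (ereal_sup
    ((fun k => (u k)%:E) @` [set k | u k <= l + eps]))).
  by apply: ereal_inf_lbound; exists [set k | u k <= l + eps].
by apply: ge_ereal_sup => _ [k /= h <-]; rewrite lee_fin.
Qed.

Lemma drcs_limsup (R : realType) (d r N : nat) (e : rel 'I_N) (W : 'M[R]_N)
    t (alpha rho : R) (x : nat -> 'I_N -> 'M[R]_(d, r))
    (xbar : nat -> 'M[R]_(d, r)) :
  (0 < r)%N -> (0 < N)%N -> communication_matrix e W ->
  (forall k i, Stiefel (x k i)) ->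
  (forall k i, x k.+1 i = drcs_step W t alpha (x k) i) ->
  (forall k, is_IAM (x k) (xbar k)) ->
  (fun k => consensus_err (x k) (xbar k)) @ \oo --> (0 : R) ->
  (forall k, x k <> (fun=> xbar k)) -> 0 <= rho ->
  (forall n (Y : 'M[R]_(N, n)), (forall j, \sum_k Y k j = 0) ->
     fnorm (mixing_mx W t alpha *m Y) <= rho * fnorm Y) ->
  (limn_esup (fun k => (consensus_err (x k.+1) (xbar k.+1) /
     consensus_err (x k) (xbar k))%:E) <= rho%:E)%E.
Proof.
move=> r0 N0 hW hx hstep hI E0 hne rho0 hmix.
pose E k := consensus_err (x k) (xbar k).
apply: (limn_esup_le_linear
  (c := (rho + 1) / 2 + N%:R * (2 * `|alpha| + 16 * alpha ^+ 2)) _ E0).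
  apply: addr_ge0; first by rewrite divr_ge0 // addr_ge0.
  by rewrite mulr_ge0 // addr_ge0 // mulr_ge0 // sqr_ge0.
have /cvgrPdist_le /(_ 1 ltr01) := E0; apply: filterS => k.
rewrite sub0r normrN => /(le_trans (ler_norm _)) E1.
have Egt0 : 0 < E k.
  rewrite lt_neqAle sqrtr_ge0 andbT eq_sym; apply/eqP => Ek0.
  apply: (hne k); apply/funext => i; apply/eqP; rewrite -subr_eq0; apply/eqP.
  apply: fnorm_eq0; apply/le_anti; rewrite fnorm_ge0 andbT -Ek0.
  exact: (fnorm_le_stack_norm (fun i => x k i - xbar k)).
have stepE : x k.+1 = drcs_step W t alpha (x k) by apply/funext => i.
(* The next iterate lies in [Stiefel], which supplies the membership that [polar_retr_approx] asks
   of the retracted point. *)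
have hstep' i : Stiefel (drcs_step W t alpha (x k) i) by rewrite -hstep.
have := consensus_err_step r0 N0 hW (hx k) (hI k) hstep' E1 rho0 hmix.
rewrite -stepE => h; rewrite ler_pdivrMr // mulrDl -mulrA -expr2.
(* [xbar k] competes in the minimization defining [xbar k.+1], so passing to the new IAM cannot
   increase the error. *)
apply: le_trans h; have [_ hmin] := hI k.+1.
rewrite ler_wsqrtr //; have := hmin (xbar k) (proj1 (hI k)).
have sw y : \sum_i fnorm (x k.+1 i - y) ^+ 2 = \sum_i fnorm (y - x k.+1 i) ^+ 2.
  by apply: eq_bigr => i _; rewrite -fnormN opprB.
by rewrite (sw (xbar k)) (sw (xbar k.+1)).
Qed.

Theorem mainTheorem2 (R : realType) (d r N : nat)
    (hr : (1 <= r)%N) (hrd : (r <= d)%N) (hN : (2 <= N)%N)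
    (e : rel 'I_N) (W : 'M[R]_N) (hW : communication_matrix e W)
    (t : nat) (ht : (1 <= t)%N) (alpha : R)
    (x : nat -> 'I_N -> 'M[R]_(d, r)) (xbar : nat -> 'M[R]_(d, r))
    (hSt : forall k i, Stiefel (x k i))
    (hstep : forall k i, x k.+1 i = drcs_step W t alpha (x k) i)
    (hIAM : forall k, is_IAM (x k) (xbar k))
    (hlim : (fun k => consensus_err (x k) (xbar k)) @ \oo --> (0 : R))
    (hne : forall k, x k <> (fun=> xbar k)) :
  let L := consensus_L W t in
  let mu := consensus_mu W t in
  let ratio := fun k : nat =>
    consensus_err (x k.+1) (xbar k.+1) / consensus_err (x k) (xbar k) in
  (alpha = 2 / (L + mu) ->
     (limn_esup (fun k => (ratio k)%:E) <= ((L - mu) / (L + mu))%:E)%E /\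
     (L - mu) / (L + mu) <= singval W 2 ^+ t) /\
  (alpha = 1 ->
     (limn_esup (fun k => (ratio k)%:E) <= (singval W 2 ^+ t)%:E)%E).
Proof.
move=> L mu ratio.
have [mu0 muL rate hmix] := consensus_rates hN hW ht.
rewrite -/L -/mu in mu0 muL rate hmix.
have limsup rho : 0 <= rho -> (forall l, `|l| <= singval W 2 ^+ t ->
    1 - L <= l <= 1 - mu -> `|1 - alpha + alpha * l| <= rho) ->
    (limn_esup (fun k => (ratio k)%:E) <= rho%:E)%E.
  move=> rho0 hrho; have := hmix alpha rho rho0 hrho.
  exact: drcs_limsup (ltnW hN) hW hSt hstep hIAM hlim hne rho0.
have Lmu0 : 0 < L + mu by lra.
split=> [alphaE|alphaE]; last first.
  have /andP [sv0 _] := comm_singval2 hW.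
  apply: limsup => [|l hl _]; first exact: exprn_ge0.
  by rewrite alphaE subrr add0r mul1r.
split=> //; apply: limsup => [|l _ /andP [l1 l2]].
  by rewrite divr_ge0 ?subr_ge0 // ltW.
(* As 1 - l ranges over [mu, L], the numerator ranges over [mu - L, L - mu]; this [alpha] balances
   the two endpoints. *)
have -> : 1 - alpha + alpha * l = (L + mu - 2 * (1 - l)) / (L + mu).
  by rewrite alphaE; field; rewrite lt0r_neq0.
rewrite normrM [`|_^-1|]gtr0_norm ?invr_gt0 // ler_pM2r ?invr_gt0 //.
by rewrite ler_norml; apply/andP; split; lra.
Qed.
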